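(* Let $G(k)=\sum_{j=0}^{k-1}\frac{1}{(2j+1)^2}$ for integers $k\ge 0$, and let $x$ be a real number with $0<|x|\le 1$. For all even integers $n\geq 0$ we have $$\begin{aligned} \sum_{k=0}^\infty\frac{\binom{2k}{k}G(k)x^{2k+1}}{4^k(2k+1+n)} =\frac{\binom{n}{n/2}}{4(2x)^{n}}\Bigg(&\frac{2}{3}(\arcsin x)^3-\sqrt{1-x^2}\,(\arcsin x)^2 \sum_{j=0}^{\frac{n-2}{2}}\frac{(2x)^{2j+1}}{\binom{2j}{j}(2j+1)}\\ &+\arcsin x\sum_{j=1}^{\frac{n}{2}}\bigg(\frac{(2x)^{2j}}{\binom{2j}{j}}-1\bigg)\frac{1}{j^2}\\ &+\frac{\sqrt{1-x^2}}{2}\sum_{r=0}^{\frac{n-2}{2}}\bigg(\sum_{j=r+1}^{n/2}\frac{1}{j^2}\bigg) \frac{(2x)^{2r+1}}{\binom{2r}{r}(2r+1)}\Bigg), \end{aligned}$$ and for all odd integers $n\geq 1$, $$\begin{aligned} \sum_{k=0}^\infty\frac{\binom{2k}{k}G(k)x^{2k+1}}{4^k(2k+1+n)} =\frac{\bigl(\frac{2}{x}\bigr)^n}{2n\binom{n-1}{\frac{n-1}{2}}}\Bigg(&-\frac{\sqrt{1-x^2}\,(\arcsin x)^2}{2} \sum_{j=0}^{\frac{n-1}{2}}\binom{2j}{j}\Bigl(\frac{x}{2}\Bigr)^{2j} +2\arcsin x\sum_{j=0}^{\frac{n-1}{2}}\frac{\binom{2j}{j}}{2j+1}\Bigl(\frac{x}{2}\Bigr)^{2j+1}\\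 &+\sqrt{1-x^2}\sum_{r=0}^{\frac{n-1}{2}}\bigg(\sum_{j=r}^{\frac{n-1}{2}}\frac{1}{(2j+1)^2}\bigg)\binom{2r}{r}\Bigl(\frac{x}{2}\Bigr)^{2r} -\sum_{j=0}^{\frac{n-1}{2}}\frac{1}{(2j+1)^2}\Bigg). \end{aligned}$$
   Context: Empty sums are equal to $0$ (in particular $G(0)=0$). Here $\arcsin$ is the principal real arcsine on $[-1,1]$. *)

(* Defs.v *)
From Stdlib Require Import Reals List Arith.
From Coquelicot Require Import Coquelicot.

Open Scope R_scope.

(* Half-open range a <= j < b, so that sums whose upper limit would be -1
   are the empty range. *)
Definition sum_range (a b : nat) (f : nat -> R) : R :=
  fold_right Rplus 0 (map f (seq a (b - a))).

Notation "'Sum_{' a '<=' j '<' b '}' e" :=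
  (sum_range a b (fun j : nat => e))
  (at level 36, a at level 69, j name, b at level 69, e at level 36,
   format "'Sum_{'  a  '<='  j  '<'  b  '}'  e") : R_scope.

(* Coquelicot reuses the name [C] for the complex numbers. *)
Notation binom := Binomial.C.

Definition G (k : nat) : R :=
  Sum_{ 0 <= j < k } (1 / INR (2 * j + 1) ^ 2).

Definition lhs_term (n : nat) (x : R) (k : nat) : R :=
  (binom (2 * k) k * G k * x ^ (2 * k + 1)) / (4 ^ k * INR (2 * k + 1 + n)).

(* Main.v *)
Require Import Defs.
From Stdlib Require Import Reals Arith List Lra Lia.
From Coquelicot Require Import Coquelicot.
Open Scope R_scope.

(** Put [x = sin t] and let [c_k = binom (2k) k * G k / 4^k].  The recurrences
    for [binom (2k) k / 4^k] and [c_k] turn into first-order differential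
    equations in [t] which give [cos t * sum_k c_k (sin t)^(2k) = t^2 / 2].
    Hence [x^n] times the left-hand side is the primitive of
    [(sin t)^n * t^2 / 2] vanishing at [0].  The closed forms have the same
    derivative, by induction on [n] in steps of two: the derivatives of
    [cos t * (2 sin t)^(2j+1) / (binom (2j) j * (2j+1))] and of
    [cos t * binom (2j) j * (sin t / 2)^(2j)] telescope in [j].  This settles
    [|x| < 1]; since [c_k >= 0], monotone convergence reaches [|x| = 1]. *)

(** * Finite sums over half-open ranges *)

Lemma sum_range_S (a b : nat) (f : nat -> R) :
  (a <= b)%nat -> sum_range a (S b) f = sum_range a b f + f b.
Proof.
intros Hab. unfold sum_range.
replace (S b - a)%nat with (S (b - a)) by lia.
rewrite seq_S, map_app, fold_right_app. simpl.
replace (a + (b - a))%nat with b by lia.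
rewrite Rplus_0_r. generalize (f b); intros y.
induction (map f (seq a (b - a))) as [|z l IH]; simpl; [ring|].
rewrite IH; ring.
Qed.

Lemma sum_range_nil (a : nat) (f : nat -> R) : sum_range a a f = 0.
Proof. unfold sum_range; rewrite Nat.sub_diag; reflexivity. Qed.

(** Raising the upper limit puts [g (m + i)] into every inner tail, the new tail at [r = m] being
    that single term. The shift [i] is 1 in the even closed form and 0 in the odd one. *)
Lemma sum_range_tails_S (m i : nat) (g q : nat -> R) :
  Sum_{ 0 <= r < S m } (Sum_{ r + i <= j < S m + i } (g j) * q r) =
  Sum_{ 0 <= r < m } (Sum_{ r + i <= j < m + i } (g j) * q r)
  + g (m + i)%nat * sum_range 0 (S m) q.
Proof.
rewrite sum_range_S by lia.
change (S m + i)%nat with (S (m + i)).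
rewrite !(sum_range_S (m + i)), sum_range_nil by lia.
(* The outer limit [p] is separated from the inner one, so that the induction runs over the outer
   sum while the tails stay fixed. *)
assert (H : forall p, (p <= m)%nat ->
  Sum_{ 0 <= r < p } (Sum_{ r + i <= j < S (m + i) } (g j) * q r) =
  Sum_{ 0 <= r < p } (Sum_{ r + i <= j < m + i } (g j) * q r)
  + g (m + i)%nat * sum_range 0 p q).
{ induction p as [|p IH]; intros Hp; [rewrite !sum_range_nil; ring|].
  rewrite !(sum_range_S 0), IH, !(sum_range_S (p + i)) by lia. ring. }
rewrite H, (sum_range_S 0 m q) by lia. ring.
Qed.

(** * Central binomials and the coefficient recurrences *)

Lemma binom_pos (n k : nat) : 0 < binom n k.
Proof.
unfold binom. apply Rdiv_lt_0_compat; [apply INR_fact_lt_0|].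
apply Rmult_lt_0_compat; apply INR_fact_lt_0.
Qed.

Lemma central_binom_S (m : nat) :
  binom (2 * S m) (S m) = 2 * INR (2 * m + 1) / INR (S m) * binom (2 * m) m.
Proof.
unfold binom.
replace (2 * S m - S m)%nat with (S m) by lia.
replace (2 * m - m)%nat with m by lia.
replace (2 * S m)%nat with (S (S (2 * m))) by lia.
rewrite !fact_simpl, !mult_INR.
replace (INR (S (S (2 * m)))) with (2 * INR (S m)) by (rewrite !S_INR, mult_INR; simpl; ring).
replace (S (2 * m))%nat with (2 * m + 1)%nat by lia.
assert (H1 := INR_fact_neq_0 m). assert (H2 : INR (S m) <> 0) by (apply not_0_INR; lia).
field. auto.
Qed.

Lemma central_binom_0 : binom (2 * 0) 0 = 1.
Proof. unfold binom; simpl; field. Qed.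

(** These are the Taylor coefficients of [1 / sqrt (1 - y)]; divided by [2 * k + 1] they become
    those of the arcsine, in odd powers of its argument. *)
Definition arcsin_coef (k : nat) : R := binom (2 * k) k / 4 ^ k.

Lemma arcsin_coef_S (k : nat) :
  (2 * INR k + 2) * arcsin_coef (S k) = (2 * INR k + 1) * arcsin_coef k.
Proof.
unfold arcsin_coef. rewrite central_binom_S, <- tech_pow_Rmult.
rewrite S_INR, plus_INR, mult_INR. simpl (INR 2). simpl (INR 1).
assert (H := pos_INR k). assert (H4 : 4 ^ k <> 0) by (apply pow_nonzero; lra).
field. split; [exact H4|lra].
Qed.

Lemma arcsin_coef_bound (k : nat) : 0 <= arcsin_coef k <= 1.
Proof.
induction k as [|k IH].
- unfold arcsin_coef. rewrite central_binom_0. simpl; lra.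
- assert (H := arcsin_coef_S k). assert (Hk := pos_INR k). split; nra.
Qed.

Definition G_coef (k : nat) : R := arcsin_coef k * G k.

(** [G] grows by [1 / (2 * k + 1) ^ 2] and [arcsin_coef_S] supplies one factor [2 * k + 1], so what
    remains is exactly an arcsine coefficient. *)
Lemma G_coef_S (k : nat) :
  (2 * INR k + 2) * G_coef (S k) - (2 * INR k + 1) * G_coef k
  = arcsin_coef k / (2 * INR k + 1).
Proof.
unfold G_coef, G. rewrite sum_range_S by lia.
rewrite <- Rmult_assoc, arcsin_coef_S, plus_INR, mult_INR.
simpl (INR 2). simpl (INR 1).
assert (H := pos_INR k). field. lra.
Qed.

(** By the recurrence, [G_coef (S k)] is a convex combination, with weights [(2k+1)/(2k+2)] and
    [1/(2k+2)], of [G_coef k] and a number in [0, 1]. The upper bound controls the radius of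
    convergence, the lower one serves monotone convergence. *)
Lemma G_coef_bound (k : nat) : 0 <= G_coef k <= 1.
Proof.
induction k as [|k IH].
- unfold G_coef, G. rewrite sum_range_nil. lra.
- assert (H := G_coef_S k). assert (Hk := pos_INR k).
  assert (Hb := arcsin_coef_bound k).
  assert (0 <= arcsin_coef k / (2 * INR k + 1) <= 1).
  { split; [apply Rdiv_le_0_compat; lra|]. apply Rle_div_l; lra. }
  split; nra.
Qed.

(** * Power series in [sin t ^ 2] and their derivatives in [t] *)

Lemma CV_radius_ge_1 (a : nat -> R) (y : R) :
  (forall k, Rabs (a k) <= 1) -> Rabs y < 1 -> Rbar_lt (Rabs y) (CV_radius a).
Proof.
intros Ha Hy. apply Rbar_lt_le_trans with 1; [exact Hy|].
apply (CV_radius_bounded a). exists 1. intros k.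
rewrite pow1, Rmult_1_r. apply Ha.
Qed.

Lemma is_pseries_unit_disc (a : nat -> R) (y : R) :
  (forall k, Rabs (a k) <= 1) -> Rabs y < 1 -> is_pseries a y (PSeries a y).
Proof.
intros Ha Hy. apply PSeries_correct, CV_radius_inside, CV_radius_ge_1; assumption.
Qed.

Lemma is_pseries_derive (a : nat -> R) (y : R) :
  (forall k, Rabs (a k) <= 1) -> Rabs y < 1 ->
  is_pseries (fun k => INR k * a k) y (y * PSeries (PS_derive a) y).
Proof.
intros Ha Hy.
apply (is_pseries_ext (PS_incr_1 (PS_derive a))).
{ intros [|k]; [symmetry; apply Rmult_0_l|reflexivity]. }
apply (is_pseries_incr_1 (PS_derive a)).
apply PSeries_correct, CV_radius_inside. rewrite CV_radius_derive.
apply CV_radius_ge_1; assumption.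
Qed.

Lemma Rabs_sin_sqr_lt_1 (t : R) : 0 < cos t -> Rabs (sin t ^ 2) < 1.
Proof.
intros Hc. rewrite Rabs_pos_eq by apply pow2_ge_0.
assert (C := sin2_cos2 t). unfold Rsqr in C. nra.
Qed.

Lemma is_derive_PSeries_sin (a : nat -> R) (t : R) :
  (forall k, Rabs (a k) <= 1) -> 0 < cos t ->
  is_derive (fun t => PSeries a (sin t ^ 2)) t
    (2 * sin t * cos t * PSeries (PS_derive a) (sin t ^ 2)).
Proof.
intros Ha Hc. evar_last.
{ apply (is_derive_comp (PSeries a) (fun t => sin t ^ 2)).
  - apply is_derive_PSeries, CV_radius_ge_1; [exact Ha|].
    apply Rabs_sin_sqr_lt_1, Hc.
  - auto_derive; [trivial|reflexivity]. }
unfold scal; simpl; unfold mult; simpl. ring.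
Qed.

(** The division performed by integrating [x ^ (2 * k + n)]: [n = 0] with [arcsin_coef] gives the
    arcsine series, and [G_coef] gives the series of the theorem up to a factor [x]. *)
Definition integ_coef (n : nat) (a : nat -> R) (k : nat) : R := a k / INR (2 * k + 1 + n).

Lemma integ_coef_bound (n : nat) (a : nat -> R) (k : nat) :
  Rabs (a k) <= 1 -> Rabs (integ_coef n a k) <= 1.
Proof.
intros Ha. unfold integ_coef, Rdiv. rewrite Rabs_mult, Rabs_inv.
rewrite (Rabs_pos_eq (INR _)) by apply pos_INR.
assert (H : 1 <= INR (2 * k + 1 + n)) by (apply (le_INR 1); lia).
apply Rle_div_l; lra.
Qed.

(** With [b = integ_coef n a], the identity [(n + 1) * b k + 2 * k * b k = a k] is termwise
    differentiation of [x ^ (n + 1 + 2 * k)]; the factor [cos t] comes from [x = sin t]. *)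
Lemma is_derive_sin_pow_PSeries (n : nat) (a : nat -> R) (t : R) :
  (forall k, Rabs (a k) <= 1) -> 0 < cos t ->
  is_derive (fun t => sin t ^ S n * PSeries (integ_coef n a) (sin t ^ 2)) t
    (sin t ^ n * (cos t * PSeries a (sin t ^ 2))).
Proof.
intros Ha Hc.
assert (Hd : forall k, Rabs (integ_coef n a k) <= 1) by (intros; apply integ_coef_bound, Ha).
assert (Hy := Rabs_sin_sqr_lt_1 t Hc).
assert (E : PSeries a (sin t ^ 2) = INR (S n) * PSeries (integ_coef n a) (sin t ^ 2)
  + 2 * (sin t ^ 2 * PSeries (PS_derive (integ_coef n a)) (sin t ^ 2))).
{ apply is_pseries_unique.
  apply (is_pseries_ext (PS_plus (PS_scal (INR (S n)) (integ_coef n a))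
     (PS_scal 2 (fun k => INR k * integ_coef n a k)))).
  { intros k. change (INR (S n) * integ_coef n a k + 2 * (INR k * integ_coef n a k) = a k).
    unfold integ_coef. assert (H : INR (2 * k + 1 + n) <> 0) by (apply not_0_INR; lia).
    replace (INR (S n)) with (INR (2 * k + 1 + n) - 2 * INR k)
      by (rewrite S_INR, !plus_INR, mult_INR; simpl; ring).
    field. exact H. }
  apply (is_pseries_plus (V := R_NormedModule));
    apply (is_pseries_scal (V := R_NormedModule)); try (intros; apply Rmult_comm).
  - apply is_pseries_unit_disc; assumption.
  - apply is_pseries_derive; assumption. }
rewrite E.
evar_last.
{ apply (is_derive_mult (fun t => sin t ^ S n)).
  - apply is_derive_pow. apply is_derive_sin.
  - apply is_derive_PSeries_sin; assumption.
  - intros x y; apply Rmult_comm. }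
unfold plus, mult. cbn -[INR pow PSeries]. unfold mult. cbn -[INR pow PSeries].
simpl (sin t ^ S n). ring.
Qed.

(** Put [y = sin t ^ 2] and let A be the sum of the series of [a]. The derivative is [sin t] times
    [2 (1 - y) A'(y) - A(y)], and the recurrence says that this last function has coefficients
    [e]. *)
Lemma is_derive_cos_PSeries (a e : nat -> R) (t : R) :
  (forall k, Rabs (a k) <= 1) -> 0 < cos t ->
  (forall k, (2 * INR k + 2) * a (S k) - (2 * INR k + 1) * a k = e k) ->
  is_derive (fun t => cos t * PSeries a (sin t ^ 2)) t (sin t * PSeries e (sin t ^ 2)).
Proof.
intros Ha Hc He.
assert (Hy := Rabs_sin_sqr_lt_1 t Hc).
assert (E : PSeries e (sin t ^ 2) = 2 * PSeries (PS_derive a) (sin t ^ 2)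
  + (- 2 * (sin t ^ 2 * PSeries (PS_derive a) (sin t ^ 2)) + - PSeries a (sin t ^ 2))).
{ apply is_pseries_unique.
  apply (is_pseries_ext (PS_plus (PS_scal 2 (PS_derive a))
     (PS_plus (PS_scal (- 2) (fun k => INR k * a k)) (PS_opp a)))).
  { intros k. rewrite <- He.
    unfold PS_plus, PS_scal, PS_opp, PS_derive, plus, scal, opp, mult; simpl.
    unfold mult. change (match k with O => 1 | S _ => INR k + 1 end) with (INR (S k)).
    rewrite S_INR. simpl. ring. }
  apply (is_pseries_plus (V := R_NormedModule));
    [|apply (is_pseries_plus (V := R_NormedModule))].
  - apply (is_pseries_scal (V := R_NormedModule)); [apply Rmult_comm|].
    apply PSeries_correct, CV_radius_inside. rewrite CV_radius_derive.
    apply CV_radius_ge_1; assumption.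
  - apply (is_pseries_scal (V := R_NormedModule)); [apply Rmult_comm|].
    apply is_pseries_derive; assumption.
  - apply (is_pseries_opp (V := R_NormedModule)), is_pseries_unit_disc; assumption. }
rewrite E.
evar_last.
{ apply (is_derive_mult cos).
  - apply is_derive_cos.
  - apply is_derive_PSeries_sin; assumption.
  - intros x y; apply Rmult_comm. }
unfold plus, mult. cbn -[INR pow PSeries].
assert (C := sin2_cos2 t). unfold Rsqr in C.
transitivity (- sin t * PSeries a (sin t ^ 2)
  + 2 * sin t * (cos t * cos t) * PSeries (PS_derive a) (sin t ^ 2)); [ring|].
replace (cos t * cos t) with (1 - sin t * sin t) by lra. ring.
Qed.

(** The derivatives are required only for [Rabs u <= Rabs t], because the series are differentiated
    only where [cos u] is positive. *)
Lemma eq_of_is_derive_0 (f g df : R -> R) (t : R) :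
  f 0 = g 0 ->
  (forall u, Rabs u <= Rabs t -> is_derive f u (df u)) ->
  (forall u, Rabs u <= Rabs t -> is_derive g u (df u)) ->
  f t = g t.
Proof.
intros H0 Hf Hg.
assert (D : forall u, Rabs u <= Rabs t -> is_derive (fun u => f u - g u) u zero).
{ intros u Hu. evar_last.
  - apply @is_derive_minus; [apply Hf, Hu|apply Hg, Hu].
  - apply (minus_eq_zero (df u)). }
destruct (Rtotal_order t 0) as [Ht|[->|Ht]]; [|exact H0|].
- assert (E := eq_is_derive (fun u => f u - g u) t 0).
  enough (f t - g t = f 0 - g 0) by lra. apply E; [|exact Ht].
  intros u Hu. apply D. rewrite !Rabs_left1; lra.
- assert (E := eq_is_derive (fun u => f u - g u) 0 t).
  enough (f 0 - g 0 = f t - g t) by lra. apply E; [|exact Ht].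
  intros u Hu. apply D. rewrite !Rabs_pos_eq; lra.
Qed.

Lemma cos_pos_of_Rabs (t u : R) : Rabs t < PI / 2 -> Rabs u <= Rabs t -> 0 < cos u.
Proof.
intros Ht Hu. assert (H : Rabs u < PI / 2) by lra.
apply Rabs_def2 in H. apply cos_gt_0; lra.
Qed.

(** * Summing the series by comparing derivatives and values at 0 *)

Lemma arcsin_coef_abs (k : nat) : Rabs (arcsin_coef k) <= 1.
Proof. assert (H := arcsin_coef_bound k). rewrite Rabs_pos_eq; lra. Qed.

Lemma G_coef_abs (k : nat) : Rabs (G_coef k) <= 1.
Proof. assert (H := G_coef_bound k). rewrite Rabs_pos_eq; lra. Qed.

Lemma PSeries_arcsin_coef (t : R) : Rabs t < PI / 2 ->
  cos t * PSeries arcsin_coef (sin t ^ 2) = 1.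
Proof.
intros Ht.
apply (eq_of_is_derive_0 (fun t => cos t * PSeries arcsin_coef (sin t ^ 2)) (fun _ => 1)
  (fun _ => 0)).
- rewrite cos_0, sin_0. replace (0 ^ 2) with 0 by ring. rewrite PSeries_0.
  unfold arcsin_coef. rewrite central_binom_0. simpl; field.
- intros u Hu. evar_last.
  + apply (is_derive_cos_PSeries _ (fun _ => 0)).
    * apply arcsin_coef_abs.
    * apply (cos_pos_of_Rabs t); assumption.
    * intros k. rewrite arcsin_coef_S. ring.
  + rewrite PSeries_const_0. ring.
- intros u _. apply @is_derive_const.
Qed.

Lemma PSeries_arcsin (t : R) : Rabs t < PI / 2 ->
  sin t * PSeries (integ_coef 0 arcsin_coef) (sin t ^ 2) = t.
Proof.
intros Ht. rewrite <- (pow_1 (sin t)) at 1.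
apply (eq_of_is_derive_0 (fun t => sin t ^ 1 * PSeries (integ_coef 0 arcsin_coef) (sin t ^ 2))
  (fun t => t) (fun _ => 1)).
- rewrite sin_0. ring.
- intros u Hu. evar_last.
  + apply is_derive_sin_pow_PSeries; [apply arcsin_coef_abs|].
    apply (cos_pos_of_Rabs t); assumption.
  + rewrite PSeries_arcsin_coef by lra. simpl; ring.
- intros u _. apply @is_derive_id.
Qed.

(** By [G_coef_S] the left side has derivative [sin t] times the arcsine series at [sin t], which is
    [t] by [PSeries_arcsin]. *)
Lemma PSeries_G_coef (t : R) : Rabs t < PI / 2 ->
  cos t * PSeries G_coef (sin t ^ 2) = t ^ 2 / 2.
Proof.
intros Ht.
apply (eq_of_is_derive_0 (fun t => cos t * PSeries G_coef (sin t ^ 2))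
  (fun t => t ^ 2 / 2) (fun t => t)).
- rewrite cos_0, sin_0. replace (0 ^ 2) with 0 by ring. rewrite PSeries_0.
  unfold G_coef, G. rewrite sum_range_nil. field.
- intros u Hu. evar_last.
  + apply (is_derive_cos_PSeries _ (integ_coef 0 arcsin_coef)).
    * apply G_coef_abs.
    * apply (cos_pos_of_Rabs t); assumption.
    * intros k. rewrite G_coef_S. unfold integ_coef.
      rewrite Nat.add_0_r, plus_INR, mult_INR. reflexivity.
  + apply PSeries_arcsin. lra.
- intros u _. auto_derive; [trivial|]. simpl; field.
Qed.

(** Inside the disc the theorem is thereby reduced to exhibiting a primitive [V]; the two parities
    differ only in that choice. *)
Lemma PSeries_integ_G_coef (n : nat) (V : R -> R) (t : R) : Rabs t < PI / 2 ->
  V 0 = 0 -> (forall u, is_derive V u (sin u ^ n * (u ^ 2 / 2))) ->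
  sin t ^ S n * PSeries (integ_coef n G_coef) (sin t ^ 2) = V t.
Proof.
intros Ht V0 HV.
apply (eq_of_is_derive_0 (fun t => sin t ^ S n * PSeries (integ_coef n G_coef) (sin t ^ 2))
  V (fun u => sin u ^ n * (u ^ 2 / 2))).
- rewrite V0, sin_0. simpl. ring.
- intros u Hu. rewrite <- PSeries_G_coef by lra.
  apply is_derive_sin_pow_PSeries; [apply G_coef_abs|].
  apply (cos_pos_of_Rabs t); assumption.
- intros u _. apply HV.
Qed.

(** * Passing to the endpoint by monotone convergence *)

Lemma is_series_pow_limit (d y l : nat -> R) (y0 l0 : R) :
  (forall k, 0 <= d k) -> (forall i, 0 <= y i <= y0) ->
  is_lim_seq y y0 -> is_lim_seq l l0 ->
  (forall i, is_series (fun k => d k * y i ^ k) (l i)) ->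
  is_series (fun k => d k * y0 ^ k) l0.
Proof.
intros Hd Hy Ly Ll Hs.
assert (Hy0 : 0 <= y0) by (destruct (Hy 0%nat); lra).
assert (Inc : forall z, 0 <= z -> forall N,
  sum_n (fun k => d k * z ^ k) N <= sum_n (fun k => d k * z ^ k) (S N)).
{ intros z Hz N. rewrite sum_Sn. unfold plus; simpl.
  assert (0 <= d (S N) * (z * z ^ N)).
  { apply Rmult_le_pos; [apply Hd|]. apply Rmult_le_pos; [exact Hz|apply pow_le, Hz]. }
  lra. }
(* With non-negative terms, each partial sum at [y i] is at most [l i]. Partial sums are
   polynomials, so the bound survives the limit in [i]. *)
assert (Part : forall N, sum_n (fun k => d k * y0 ^ k) N <= l0).
{ intros N.
  apply (is_lim_seq_le (fun i => sum_n (fun k => d k * y i ^ k) N) l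
    (sum_n (fun k => d k * y0 ^ k) N) l0).
  - intros i. apply (is_lim_seq_incr_compare (sum_n (fun k => d k * y i ^ k))).
    + exact (Hs i).
    + apply Inc, Hy.
  - apply (is_lim_seq_continuous (fun z => sum_n (fun k => d k * z ^ k) N)); [|exact Ly].
    apply continuity_pt_filterlim.
    induction N as [|N IH].
    + apply (continuous_ext (fun z => d 0%nat * z ^ 0)).
      { intros z. rewrite sum_O. reflexivity. }
      apply (ex_derive_continuous (fun z => d 0%nat * z ^ 0)). auto_derive; trivial.
    + apply (continuous_ext (fun z => plus (sum_n (fun k => d k * z ^ k) N) (d (S N) * z ^ S N))).
      { intros z. rewrite sum_Sn. reflexivity. }
      apply @continuous_plus; [exact IH|].
      apply (ex_derive_continuous (fun z => d (S N) * z ^ S N)). auto_derive; trivial.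
  - exact Ll. }
assert (Ex : ex_series (fun k => d k * y0 ^ k)).
{ apply (ex_finite_lim_seq_incr _ l0); [apply Inc, Hy0|exact Part]. }
assert (Cor := Series_correct _ Ex).
(* One inequality is the limit of [Part]; the other compares the series at [y i] termwise with the
   one at [y0]. *)
replace l0 with (Series (fun k => d k * y0 ^ k)); [exact Cor|].
apply Rle_antisym.
- apply (is_lim_seq_le (sum_n (fun k => d k * y0 ^ k)) (fun _ => l0) (Series _) l0).
  + exact Part.
  + exact Cor.
  + apply is_lim_seq_const.
- apply (is_lim_seq_le l (fun _ => Series (fun k => d k * y0 ^ k)) l0 (Series _)).
  + intros i. rewrite <- (is_series_unique _ _ (Hs i)).
    apply Series_le; [|exact Ex].
    intros k. split.
    * apply Rmult_le_pos; [apply Hd|apply pow_le, Hy].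
    * apply Rmult_le_compat_l; [apply Hd|]. apply pow_incr, Hy.
  + exact Ll.
  + apply is_lim_seq_const.
Qed.

(** * The two closed forms and their recurrences in [m] *)

Definition even_p (j : nat) (x : R) : R := (2 * x) ^ (2 * j) / binom (2 * j) j.
Definition even_q (j : nat) (x : R) : R :=
  (2 * x) ^ (2 * j + 1) / (binom (2 * j) j * INR (2 * j + 1)).
(** The parameters [w] and [t] stand for [sqrt (1 - x ^ 2)] and [asin x]. Kept free, they can be set
    to [cos t] and [t] when [x = sin t], which leaves a function that is smooth for all [t]. *)
Definition even_bracket (m : nat) (x w t : R) : R :=
  2 / 3 * t ^ 3 - w * t ^ 2 * Sum_{ 0 <= j < m } (even_q j x)
  + t * Sum_{ 1 <= j < m + 1 } ((even_p j x - 1) * (1 / INR j ^ 2))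
  + w / 2 *
    Sum_{ 0 <= r < m } (Sum_{ r + 1 <= j < m + 1 } (1 / INR j ^ 2) * even_q r x).

Definition odd_e (j : nat) (x : R) : R := binom (2 * j) j * (x / 2) ^ (2 * j).
Definition odd_f (j : nat) (x : R) : R :=
  binom (2 * j) j / INR (2 * j + 1) * (x / 2) ^ (2 * j + 1).
Definition odd_bracket (m : nat) (x w t : R) : R :=
  - (w * t ^ 2 / 2) * Sum_{ 0 <= j < m + 1 } (odd_e j x)
  + 2 * t * Sum_{ 0 <= j < m + 1 } (odd_f j x)
  + w * Sum_{ 0 <= r < m + 1 }
      (Sum_{ r <= j < m + 1 } (1 / INR (2 * j + 1) ^ 2) * odd_e r x)
  - Sum_{ 0 <= j < m + 1 } (1 / INR (2 * j + 1) ^ 2).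

Lemma even_bracket_S (m : nat) (x w t : R) :
  even_bracket (S m) x w t = even_bracket m x w t
  - w * t ^ 2 * even_q m x
  + t * ((even_p (S m) x - 1) / INR (S m) ^ 2)
  + w * Sum_{ 0 <= r < S m } (even_q r x) / (2 * INR (S m) ^ 2).
Proof.
unfold even_bracket. change (S m + 1)%nat with (S (m + 1)).
(* Only the double sum returns to the shape expected by [sum_range_tails_S]; the single sum keeps
   its successor limit. *)
change (S (m + 1)) with (S m + 1)%nat at 2.
rewrite (sum_range_tails_S m 1 (fun j => 1 / INR j ^ 2) (fun r => even_q r x)).
rewrite (sum_range_S 1 (m + 1)), !(sum_range_S 0 m) by lia.
replace (m + 1)%nat with (S m) by lia.
assert (H : INR (S m) <> 0) by (apply not_0_INR; lia).
field. exact H.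
Qed.

Lemma odd_bracket_init (x w t : R) :
  odd_bracket 0 x w t = - (w * t ^ 2 / 2) + t * x + w - 1.
Proof.
unfold odd_bracket. simpl (0 + 1)%nat.
rewrite !(sum_range_S 0 0), !sum_range_nil by lia.
unfold odd_e, odd_f. rewrite central_binom_0. simpl. field.
Qed.

Lemma odd_bracket_S (m : nat) (x w t : R) :
  odd_bracket (S m) x w t = odd_bracket m x w t
  - w * t ^ 2 / 2 * odd_e (S m) x + 2 * t * odd_f (S m) x
  + (w * Sum_{ 0 <= r < S (S m) } (odd_e r x) - 1) / INR (2 * S m + 1) ^ 2.
Proof.
(* The tails start at [r] itself, so the shift 0 is written out to match [sum_range_tails_S]. *)
assert (T : forall p, Sum_{ 0 <= r < p }
      (Sum_{ r <= j < p } (1 / INR (2 * j + 1) ^ 2) * odd_e r x) =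
      Sum_{ 0 <= r < p }
      (Sum_{ r + 0 <= j < p + 0 } (1 / INR (2 * j + 1) ^ 2) * odd_e r x)).
{ intros p. unfold sum_range at 1 3. f_equal. apply map_ext. intros r.
  rewrite !Nat.add_0_r. reflexivity. }
unfold odd_bracket. rewrite !T.
replace (S m + 1)%nat with (S (S m)) by lia.
replace (m + 1)%nat with (S m) by lia.
rewrite (sum_range_tails_S (S m) 0
  (fun j => 1 / INR (2 * j + 1) ^ 2) (fun r => odd_e r x)).
rewrite Nat.add_0_r, !(sum_range_S 0 (S m)) by lia.
assert (H : INR (2 * S m + 1) <> 0) by (apply not_0_INR; lia).
field. exact H.
Qed.

(** * Telescoping derivatives for even exponents *)

Lemma is_derive_pow_sin (a : R) (k : nat) (t : R) :
  is_derive (fun t => (a * sin t) ^ S k) t (INR (S k) * (a * cos t) * (a * sin t) ^ k).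
Proof.
apply (is_derive_pow (fun t => a * sin t) (S k) t (a * cos t)).
auto_derive; [trivial|ring].
Qed.

Lemma INR_double_S (m : nat) : INR (2 * m + 1) = 2 * INR m + 1.
Proof. rewrite plus_INR, mult_INR. simpl. ring. Qed.

Lemma even_p_S (m : nat) (x : R) : even_p (S m) x = INR (S m) * x * even_q m x.
Proof.
unfold even_p, even_q. rewrite central_binom_S, INR_double_S, S_INR.
replace (2 * S m)%nat with (S (2 * m + 1)) by lia.
rewrite <- tech_pow_Rmult.
assert (H := pos_INR m). assert (Hb := binom_pos (2 * m) m).
field. lra.
Qed.

Lemma is_derive_even_p_S (m : nat) (t : R) :
  is_derive (fun t => even_p (S m) (sin t)) t
    (2 * INR (S m) ^ 2 * cos t * even_q m (sin t)).
Proof.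
unfold even_p, even_q. rewrite central_binom_S, INR_double_S, S_INR.
assert (H := pos_INR m). assert (Hb := binom_pos (2 * m) m).
replace (2 * S m)%nat with (S (2 * m + 1)) by lia.
evar_last.
{ apply (is_derive_ext (fun t => / (2 * (2 * INR m + 1) / (INR m + 1) * binom (2 * m) m)
    * (2 * sin t) ^ S (2 * m + 1))).
  { intros u. unfold Rdiv. apply Rmult_comm. }
  apply is_derive_scal. apply is_derive_pow_sin. }
rewrite S_INR, INR_double_S. field. lra.
Qed.

(** After [cos t ^ 2] becomes [1 - sin t ^ 2], every term except [2 * even_p m] is a multiple of
    [sin t * even_q m], and [even_p_S] identifies their total as [- 2 * even_p (S m)]. Consecutive
    indices therefore telescope. *)
Lemma is_derive_cos_even_q (m : nat) (t : R) :
  is_derive (fun t => cos t * even_q m (sin t)) t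
    (2 * even_p m (sin t) - 2 * even_p (S m) (sin t)).
Proof.
assert (H := pos_INR m). assert (Hb := binom_pos (2 * m) m).
assert (Hq : is_derive (fun t => even_q m (sin t)) t (2 * cos t * even_p m (sin t))).
{ unfold even_q, even_p. rewrite INR_double_S.
  replace (2 * m + 1)%nat with (S (2 * m)) by lia.
  evar_last.
  { apply (is_derive_ext (fun t => / (binom (2 * m) m * (2 * INR m + 1))
      * (2 * sin t) ^ S (2 * m))).
    { intros u. unfold Rdiv. apply Rmult_comm. }
    apply is_derive_scal. apply is_derive_pow_sin. }
  rewrite S_INR, mult_INR. simpl (INR 2). field. lra. }
evar_last.
{ apply (is_derive_mult cos (fun t => even_q m (sin t))).
  - apply is_derive_cos. 
  - exact Hq.
  - intros a b; apply Rmult_comm. }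
unfold plus, mult; simpl.
assert (E : even_q m (sin t) * (2 * INR m + 1) = 2 * sin t * even_p m (sin t)).
{ unfold even_q, even_p. rewrite INR_double_S, pow_add, pow_1. field. lra. }
rewrite even_p_S, S_INR.
assert (C := sin2_cos2 t). unfold Rsqr in C.
replace (cos t * (2 * cos t * even_p m (sin t))) with
  (2 * even_p m (sin t) * (1 - sin t * sin t)) by (replace 1 with (sin t * sin t + cos t * cos t) by exact C; ring).
replace (2 * even_p m (sin t) * (1 - sin t * sin t)) with
  (2 * even_p m (sin t) - sin t * (2 * sin t * even_p m (sin t))) by ring.
rewrite <- E. ring.
Qed.

Lemma is_derive_cos_sum_even_q (m : nat) (t : R) :
  is_derive (fun t => cos t * Sum_{ 0 <= r < m } (even_q r (sin t))) t
    (2 - 2 * even_p m (sin t)).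
Proof.
induction m as [|m IH].
- evar_last.
  { apply (is_derive_ext (fun _ => 0)); [|apply is_derive_const].
    intros u. rewrite sum_range_nil. symmetry; apply Rmult_0_r. }
  unfold even_p. rewrite central_binom_0. simpl. unfold zero; simpl. field.
- apply (is_derive_ext (fun t => cos t * Sum_{ 0 <= r < m } (even_q r (sin t))
    + cos t * even_q m (sin t))).
  { intros u. rewrite (sum_range_S 0 m) by lia. simpl. ring. }
  evar_last.
  { apply @is_derive_plus; [exact IH|apply is_derive_cos_even_q]. }
  unfold plus; simpl. ring.
Qed.

(** Among the terms added by [even_bracket_S], the parts linear in [t] coming from [even_q] and
    [even_p] cancel, and [(even_p (S m) - 1) / INR (S m) ^ 2] is cancelled by the derivative of the
    cosine sum; this is why the closed form contains the -1. The [t ^ 2] part replaces [even_p m] by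
    [even_p (S m)]. *)
Lemma is_derive_even_bracket (m : nat) (t : R) :
  is_derive (fun t => even_bracket m (sin t) (cos t) t) t
    (2 * even_p m (sin t) * t ^ 2).
Proof.
induction m as [|m IH].
- apply (is_derive_ext (fun t => 2 / 3 * t ^ 3)).
  { intros u. unfold even_bracket. rewrite !sum_range_nil. simpl. field. }
  unfold even_p. rewrite central_binom_0.
  auto_derive; [trivial|]. simpl. field.
- apply (is_derive_ext (fun t => even_bracket m (sin t) (cos t) t
    - t ^ 2 * (cos t * even_q m (sin t))
    + t * ((even_p (S m) (sin t) - 1) / INR (S m) ^ 2)
    + (cos t * Sum_{ 0 <= r < S m } (even_q r (sin t))) / (2 * INR (S m) ^ 2))).
  { intros u. rewrite even_bracket_S. simpl; ring. }
  (* Naming the four functions lets [auto_derive] treat them as atoms whose derivatives are supplied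
     afterwards. *)
  set (F := fun t => even_bracket m (sin t) (cos t) t).
  set (Q := fun t => cos t * even_q m (sin t)).
  set (P := fun t => even_p (S m) (sin t)).
  set (T := fun t => cos t * Sum_{ 0 <= r < S m } (even_q r (sin t))).
  assert (HF : is_derive F t _) by exact IH.
  assert (HQ : is_derive Q t _) by exact (is_derive_cos_even_q m t).
  assert (HP : is_derive P t _) by exact (is_derive_even_p_S m t).
  assert (HT : is_derive T t _) by exact (is_derive_cos_sum_even_q (S m) t).
  apply (is_derive_ext (fun t => F t - t ^ 2 * Q t + t * ((P t - 1) / INR (S m) ^ 2)
    + T t / (2 * INR (S m) ^ 2))); [reflexivity|].
  assert (H : INR (S m) <> 0) by (apply not_0_INR; lia).
  auto_derive.
  { repeat split; eexists; eassumption. }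
  change (match m with O => 1 | S _ => INR m + 1 end) with (INR (S m)).
  rewrite (is_derive_unique (fun x : R => F x) _ _ HF), (is_derive_unique (fun x : R => Q x) _ _ HQ),
    (is_derive_unique (fun x : R => P x) _ _ HP), (is_derive_unique (fun x : R => T x) _ _ HT).
  unfold Q, P. set (N := INR (S m)) in *. clearbody N. field. exact H.
Qed.

Lemma even_bracket_0 (m : nat) : even_bracket m 0 1 0 = 0.
Proof.
assert (Hq : forall j, even_q j 0 = 0).
{ intros j. unfold even_q. rewrite Rmult_0_r, pow_i by lia. unfold Rdiv; ring. }
assert (Hs : forall p, Sum_{ 0 <= r < p } (even_q r 0) = 0).
{ induction p as [|p IH]; [apply sum_range_nil|].
  rewrite sum_range_S, IH, Hq by lia; ring. }
induction m as [|m IH].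
- unfold even_bracket. rewrite !sum_range_nil. field.
- rewrite even_bracket_S, IH, Hq, Hs. unfold Rdiv. ring.
Qed.

(** * Telescoping derivatives for odd exponents *)

Definition odd_w (m : nat) (x : R) : R := INR (2 * m + 1) ^ 2 * odd_f m x.

Lemma is_derive_odd_f (m : nat) (t : R) :
  is_derive (fun t => odd_f m (sin t)) t (cos t * odd_e m (sin t) / 2).
Proof.
unfold odd_f, odd_e. assert (H := pos_INR m).
replace (2 * m + 1)%nat with (S (2 * m)) by lia.
evar_last.
{ apply is_derive_scal.
  apply (is_derive_ext (fun t => (/ 2 * sin t) ^ S (2 * m))).
  { intros u. f_equal. unfold Rdiv; ring. }
  apply is_derive_pow_sin. }
replace (/ 2 * sin t) with (sin t / 2) by (unfold Rdiv; ring).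
rewrite S_INR, mult_INR. simpl (INR 2). field. lra.
Qed.

(** Here [odd_w] plays the telescoping role of [even_p]. Index 0 is left out: [odd_e 0] is 1, and
    the derivative [- sin t] of the cosine is [- 2 * odd_w 0], which starts the telescope in the
    next lemma. *)
Lemma is_derive_cos_odd_e_S (m : nat) (t : R) :
  is_derive (fun t => cos t * odd_e (S m) (sin t)) t
    (2 * odd_w m (sin t) - 2 * odd_w (S m) (sin t)).
Proof.
assert (H := pos_INR m). assert (Hb := binom_pos (2 * m) m).
unfold odd_e, odd_w, odd_f. rewrite central_binom_S, !INR_double_S, !S_INR.
replace (2 * S m + 1)%nat with (S (S (2 * m + 1))) by lia.
replace (2 * S m)%nat with (S (2 * m + 1)) by lia.
set (B := 2 * (2 * INR m + 1) / (INR m + 1) * binom (2 * m) m).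
evar_last.
{ apply (is_derive_ext (fun t => cos t * (B * (/ 2 * sin t) ^ S (2 * m + 1)))).
  { intros u. do 3 f_equal. unfold Rdiv; ring. }
  apply (is_derive_mult cos).
  - apply is_derive_cos.
  - apply is_derive_scal. apply is_derive_pow_sin.
  - intros a b; apply Rmult_comm. }
unfold plus, mult. cbn -[INR pow Nat.mul Nat.add]. unfold mult. cbn -[INR pow Nat.mul Nat.add].
rewrite S_INR, INR_double_S, <- !tech_pow_Rmult.
replace (sin t / 2) with (/ 2 * sin t) by (unfold Rdiv; ring).
set (z := (/ 2 * sin t) ^ (2 * m + 1)).
assert (C := sin2_cos2 t). unfold Rsqr in C.
replace (cos t * (B * ((2 * INR m + 1 + 1) * (/ 2 * cos t) * z))) with
  (B * (INR m + 1) * z * (1 - sin t * sin t))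
  by (replace 1 with (sin t * sin t + cos t * cos t) at 2 by exact C; field).
unfold B. field. lra.
Qed.

Lemma is_derive_cos_sum_odd_e (m : nat) (t : R) :
  is_derive (fun t => cos t * Sum_{ 0 <= r < S m } (odd_e r (sin t))) t
    (- 2 * odd_w m (sin t)).
Proof.
induction m as [|m IH].
- apply (is_derive_ext cos).
  { intros u. unfold odd_e. rewrite sum_range_S, sum_range_nil, central_binom_0 by lia.
    simpl. ring. }
  evar_last; [apply is_derive_cos|].
  unfold odd_w, odd_f. rewrite central_binom_0. simpl. field.
- apply (is_derive_ext (fun t => cos t * Sum_{ 0 <= r < S m } (odd_e r (sin t))
    + cos t * odd_e (S m) (sin t))).
  { intros u. rewrite (sum_range_S 0 (S m)) by lia. cbn -[sum_range odd_e]. ring. }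
  evar_last.
  { apply @is_derive_plus; [exact IH|apply is_derive_cos_odd_e_S]. }
  unfold plus; simpl. ring.
Qed.

(** In the increment from [odd_bracket_S], the terms [t * cos t * odd_e (S m)] cancel, and the
    cosine sum over [INR (2 * S m + 1) ^ 2] contributes [- 2 * odd_f (S m)], cancelling the
    derivative of the factor [2 * t]. Only the change of [odd_w] times [t ^ 2] is left. *)
Lemma is_derive_odd_bracket (m : nat) (t : R) :
  is_derive (fun t => odd_bracket m (sin t) (cos t) t) t (odd_w m (sin t) * t ^ 2).
Proof.
induction m as [|m IH].
- apply (is_derive_ext (fun t => - (cos t * t ^ 2 / 2) + t * sin t + cos t - 1)).
  { intros u. symmetry. apply odd_bracket_init. }
  unfold odd_w, odd_f. rewrite central_binom_0.
  auto_derive; [trivial|]. cbn. field.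
- apply (is_derive_ext (fun t => odd_bracket m (sin t) (cos t) t
    - t ^ 2 / 2 * (cos t * odd_e (S m) (sin t)) + 2 * t * odd_f (S m) (sin t)
    + (cos t * Sum_{ 0 <= r < S (S m) } (odd_e r (sin t)) - 1)
      / INR (2 * S m + 1) ^ 2)).
  { intros u. rewrite odd_bracket_S. unfold Rdiv. simpl. ring. }
  set (F := fun t => odd_bracket m (sin t) (cos t) t).
  set (E := fun t => cos t * odd_e (S m) (sin t)).
  set (f := fun t => odd_f (S m) (sin t)).
  set (T := fun t => cos t * Sum_{ 0 <= r < S (S m) } (odd_e r (sin t))).
  set (N := INR (2 * S m + 1)).
  assert (HF : is_derive F t _) by exact IH.
  assert (HE : is_derive E t _) by exact (is_derive_cos_odd_e_S m t).
  assert (Hf : is_derive f t _) by exact (is_derive_odd_f (S m) t).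
  assert (HT : is_derive T t _) by exact (is_derive_cos_sum_odd_e (S m) t).
  apply (is_derive_ext (fun t => F t - t ^ 2 / 2 * E t + 2 * t * f t
    + (T t - 1) / N ^ 2)); [reflexivity|].
  assert (H : N <> 0) by (apply not_0_INR; lia).
  auto_derive.
  { repeat split; eexists; eassumption. }
  rewrite (is_derive_unique (fun x : R => F x) _ _ HF), (is_derive_unique (fun x : R => E x) _ _ HE),
    (is_derive_unique (fun x : R => f x) _ _ Hf), (is_derive_unique (fun x : R => T x) _ _ HT).
  unfold E, f, odd_w. fold N. clearbody N. field. exact H.
Qed.

(** At 0 only [odd_e 0 = 1] survives, so the double sum reduces to the sum of
    [1 / INR (2 * j + 1) ^ 2]; the last term of the closed form subtracts precisely this. *)
Lemma odd_bracket_0 (m : nat) : odd_bracket m 0 1 0 = 0.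
Proof.
assert (He : forall j, odd_e (S j) 0 = 0).
{ intros j. unfold odd_e. replace (0 / 2) with 0 by field. rewrite pow_i by lia. ring. }
assert (Hs : forall p, Sum_{ 0 <= r < S p } (odd_e r 0) = 1).
{ induction p as [|p IH].
  - unfold odd_e. rewrite sum_range_S, sum_range_nil, central_binom_0 by lia. simpl. ring.
  - rewrite sum_range_S, IH, He by lia; ring. }
induction m as [|m IH].
- rewrite odd_bracket_init. field.
- rewrite odd_bracket_S, IH, Hs, He. unfold Rdiv. ring.
Qed.

(** * Primitives of [sin t ^ n * t ^ 2 / 2] *)

Lemma is_derive_even_primitive (m : nat) (t : R) :
  is_derive (fun t => binom (2 * m) m / (4 * 4 ^ m) * even_bracket m (sin t) (cos t) t) t
    (sin t ^ (2 * m) * (t ^ 2 / 2)).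
Proof.
(* The constant is the prefactor of the theorem times [x ^ (2 * m)]; it turns [2 * even_p m (sin t)]
   into [sin t ^ (2 * m) / 2]. *)
evar_last; [apply is_derive_scal, is_derive_even_bracket|].
unfold even_p. rewrite Rpow_mult_distr, (pow_mult 2 2 m).
replace (2 ^ 2) with 4 by ring.
assert (Hb := binom_pos (2 * m) m). assert (H4 : 4 ^ m <> 0) by (apply pow_nonzero; lra).
field. split; lra.
Qed.

Lemma is_derive_odd_primitive (m : nat) (t : R) :
  is_derive (fun t => 2 ^ (2 * m + 1) / (2 * INR (2 * m + 1) * binom (2 * m) m)
    * odd_bracket m (sin t) (cos t) t) t
    (sin t ^ (2 * m + 1) * (t ^ 2 / 2)).
Proof.
evar_last; [apply is_derive_scal, is_derive_odd_bracket|].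
unfold odd_w, odd_f, Rdiv. rewrite Rpow_mult_distr, pow_inv.
assert (Hb := binom_pos (2 * m) m). assert (H2 : 2 ^ (2 * m + 1) <> 0) by (apply pow_nonzero; lra).
assert (Hn : INR (2 * m + 1) <> 0) by (apply not_0_INR; lia).
field. repeat split; lra.
Qed.

(** * Reaching every [x] with [0 < Rabs x <= 1] *)

Lemma sin_sqr_le (u t : R) :
  Rabs u <= Rabs t -> Rabs t <= PI / 2 -> sin u ^ 2 <= sin t ^ 2.
Proof.
intros Hu Ht.
assert (A : forall v, sin (Rabs v) ^ 2 = sin v ^ 2).
{ intros v. unfold Rabs. destruct (Rcase_abs v); [rewrite sin_neg; ring|reflexivity]. }
rewrite <- (A u), <- (A t). assert (P := PI_RGT_0).
assert (H0 := Rabs_pos u).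
apply pow_incr. split; [apply sin_ge_0; lra|apply sin_incr_1; lra].
Qed.

(** Interior points and endpoints are treated alike: the identity holds at angles strictly inside
    the interval, and these tend to [asin x]. *)
Lemma is_series_lhs_term (n : nat) (V : R -> R) (x : R) :
  0 < Rabs x <= 1 -> V 0 = 0 ->
  (forall u, is_derive V u (sin u ^ n * (u ^ 2 / 2))) ->
  is_series (lhs_term n x) (V (asin x) / x ^ n).
Proof.
intros Hx V0 HV.
assert (Hx0 : x <> 0) by (intros ->; rewrite Rabs_R0 in Hx; lra).
assert (Hx1 : -1 <= x <= 1) by (apply Rabs_le_between; lra).
set (th := asin x).
assert (Hs : sin th = x) by (apply sin_asin, Hx1).
assert (Hth : Rabs th <= PI / 2) by (apply Rabs_le_between; assert (B := asin_bound x); unfold th; lra).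
assert (Hth0 : th <> 0) by (intros E; rewrite E, sin_0 in Hs; auto).
assert (P0 := Rabs_pos_lt th Hth0).
(* Adding 2 keeps the factor strictly between 0 and 1 already at [i = 0], so [ti i] is non-zero and
   strictly closer to 0 than [th]. *)
set (ti := fun i : nat => th * (1 - / (INR i + 2))).
assert (Hti : forall i, 0 < Rabs (ti i) < Rabs th).
{ intros i. unfold ti. assert (Hi := pos_INR i). rewrite Rabs_mult.
  assert (0 < / (INR i + 2) < 1).
  { split; [apply Rinv_0_lt_compat; lra|]. replace 1 with (/ 1) by field. apply Rinv_lt_contravar; lra. }
  rewrite (Rabs_pos_eq (1 - _)) by lra. split; nra. }
assert (Hsi : forall i, sin (ti i) <> 0).
{ intros i E. destruct (Hti i) as [H1 H2]. assert (PP := PI_RGT_0).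
  assert (sin (Rabs (ti i)) = 0).
  { unfold Rabs. destruct (Rcase_abs (ti i)); [rewrite sin_neg, E; ring|exact E]. }
  assert (0 < sin (Rabs (ti i))) by (apply sin_gt_0; lra). lra. }
assert (Lt : is_lim_seq ti th).
{ replace (Finite th) with (Rbar_mult th (1 - 0)) by (simpl; f_equal; ring).
  apply is_lim_seq_scal_l.
  apply is_lim_seq_minus'; [apply is_lim_seq_const|].
  apply (is_lim_seq_inv _ p_infty); [|discriminate].
  apply (is_lim_seq_plus _ _ p_infty 2 p_infty);
    [apply is_lim_seq_INR|apply is_lim_seq_const|reflexivity]. }
set (d := integ_coef n G_coef).
assert (Ser : is_series (fun k => d k * (x ^ 2) ^ k) (V th / x ^ S n)).
{ apply (is_series_pow_limit d (fun i => sin (ti i) ^ 2) (fun i => V (ti i) / sin (ti i) ^ S n)).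
  - intros k. unfold d, integ_coef. apply Rdiv_le_0_compat; [apply G_coef_bound|].
    apply lt_0_INR; lia.
  - intros i. split; [apply pow2_ge_0|]. rewrite <- Hs.
    apply sin_sqr_le; [apply Rlt_le, Hti|exact Hth].
  - rewrite <- Hs.
    apply (is_lim_seq_continuous (fun t => sin t ^ 2)); [|exact Lt].
    apply derivable_continuous_pt, ex_derive_Reals_0. auto_derive; trivial.
  - rewrite <- Hs.
    apply (is_lim_seq_continuous (fun t => V t / sin t ^ S n)); [|exact Lt].
    apply derivable_continuous_pt, ex_derive_Reals_0.
    apply ex_derive_div; [eexists; apply HV|auto_derive; trivial|].
    apply pow_nonzero. rewrite Hs; exact Hx0.
  - intros i.
    assert (Hi : Rabs (ti i) < PI / 2) by (destruct (Hti i); lra).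
    assert (E := PSeries_integ_G_coef n V (ti i) Hi V0 HV).
    replace (V (ti i) / sin (ti i) ^ S n) with (PSeries d (sin (ti i) ^ 2)).
    + apply is_pseries_R, is_pseries_unit_disc.
      * intros k. apply integ_coef_bound, G_coef_abs.
      * apply Rabs_sin_sqr_lt_1, (cos_pos_of_Rabs (ti i)); [exact Hi|apply Rle_refl].
    + rewrite <- E. fold d. field. apply pow_nonzero, Hsi. }
(* The summand has odd degree in [x]; one factor [x] is split off to leave a series in [x ^ 2], and
   it lowers [x ^ S n] to [x ^ n] in the value. *)
apply (is_series_ext (fun k => x * (d k * (x ^ 2) ^ k))).
{ intros k. symmetry. change (lhs_term n x k = x * (d k * (x ^ 2) ^ k)).
  unfold lhs_term, d, integ_coef, G_coef, arcsin_coef.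
  rewrite <- pow_mult, pow_add, pow_1.
  assert (INR (2 * k + 1 + n) <> 0) by (apply not_0_INR; lia).
  assert (4 ^ k <> 0) by (apply pow_nonzero; lra).
  field. split; assumption. }
replace (V th / x ^ n) with (x * (V th / x ^ S n)).
- apply (is_series_scal_l x _ _ Ser).
- simpl. field. split; [apply pow_nonzero|]; exact Hx0.
Qed.

Theorem theorem6p2 (x : R) (hx : 0 < Rabs x <= 1) :
  (forall n : nat, Nat.Even n ->
    is_series (lhs_term n x)
      (binom n (n / 2) / (4 * (2 * x) ^ n) *
        (2 / 3 * asin x ^ 3
         - sqrt (1 - x ^ 2) * asin x ^ 2 *
             Sum_{ 0 <= j < n / 2 }
               ((2 * x) ^ (2 * j + 1) / (binom (2 * j) j * INR (2 * j + 1)))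
         + asin x *
             Sum_{ 1 <= j < n / 2 + 1 }
               (((2 * x) ^ (2 * j) / binom (2 * j) j - 1) * (1 / INR j ^ 2))
         + sqrt (1 - x ^ 2) / 2 *
             Sum_{ 0 <= r < n / 2 }
               (Sum_{ r + 1 <= j < n / 2 + 1 } (1 / INR j ^ 2) *
                ((2 * x) ^ (2 * r + 1) / (binom (2 * r) r * INR (2 * r + 1)))))))
  /\
  (forall n : nat, Nat.Odd n ->
    is_series (lhs_term n x)
      ((2 / x) ^ n / (2 * INR n * binom (n - 1) ((n - 1) / 2)) *
        (- (sqrt (1 - x ^ 2) * asin x ^ 2 / 2) *
             Sum_{ 0 <= j < (n - 1) / 2 + 1 }
               (binom (2 * j) j * (x / 2) ^ (2 * j))
         + 2 * asin x *
             Sum_{ 0 <= j < (n - 1) / 2 + 1 }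
               (binom (2 * j) j / INR (2 * j + 1) * (x / 2) ^ (2 * j + 1))
         + sqrt (1 - x ^ 2) *
             Sum_{ 0 <= r < (n - 1) / 2 + 1 }
               (Sum_{ r <= j < (n - 1) / 2 + 1 } (1 / INR (2 * j + 1) ^ 2) *
                (binom (2 * r) r * (x / 2) ^ (2 * r)))
         - Sum_{ 0 <= j < (n - 1) / 2 + 1 } (1 / INR (2 * j + 1) ^ 2)))).
Proof.
assert (Hx0 : x <> 0) by (intros ->; rewrite Rabs_R0 in hx; lra).
assert (Hx1 : -1 <= x <= 1) by (apply Rabs_le_between; lra).
assert (Hs : sin (asin x) = x) by (apply sin_asin, Hx1).
assert (Hc : cos (asin x) = sqrt (1 - x ^ 2)).
{ rewrite cos_asin by exact Hx1. f_equal. unfold Rsqr; ring. }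
split; intros n [m ->].
- replace (2 * m / 2)%nat with m by (rewrite Nat.mul_comm, Nat.div_mul; lia).
  fold (even_bracket m x (sqrt (1 - x ^ 2)) (asin x)).
  assert (S := is_series_lhs_term (2 * m)
    (fun t => binom (2 * m) m / (4 * 4 ^ m) * even_bracket m (sin t) (cos t) t) x hx).
  evar_last.
  { apply S.
    - rewrite sin_0, cos_0, even_bracket_0. ring.
    - apply is_derive_even_primitive. }
  cbv beta. rewrite Hs, Hc, Rpow_mult_distr, (pow_mult 2 2 m).
  replace (2 ^ 2) with 4 by ring.
  assert (4 ^ m <> 0) by (apply pow_nonzero; lra).
  assert (x ^ (2 * m) <> 0) by (apply pow_nonzero, Hx0).
  change (binom (2 * m) m / (4 * 4 ^ m) * even_bracket m x (sqrt (1 - x ^ 2)) (asin x)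
      / x ^ (2 * m) = binom (2 * m) m / (4 * (4 ^ m * x ^ (2 * m)))
      * even_bracket m x (sqrt (1 - x ^ 2)) (asin x)).
  field. split; assumption.
- replace (2 * m + 1 - 1)%nat with (2 * m)%nat by lia.
  replace (2 * m / 2)%nat with m by (rewrite Nat.mul_comm, Nat.div_mul; lia).
  assert (S := is_series_lhs_term (2 * m + 1)
    (fun t => 2 ^ (2 * m + 1) / (2 * INR (2 * m + 1) * binom (2 * m) m)
      * odd_bracket m (sin t) (cos t) t) x hx).
  evar_last.
  { apply S.
    - rewrite sin_0, cos_0, odd_bracket_0. ring.
    - apply is_derive_odd_primitive. }
  cbv beta. rewrite Hs, Hc. 
  replace ((2 / x) ^ (2 * m + 1)) with (2 ^ (2 * m + 1) / x ^ (2 * m + 1))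
    by (unfold Rdiv; rewrite Rpow_mult_distr, pow_inv; reflexivity).
  assert (x ^ (2 * m + 1) <> 0) by (apply pow_nonzero, Hx0).
  assert (INR (2 * m + 1) <> 0) by (apply not_0_INR; lia).
  assert (Hb := binom_pos (2 * m) m).
  (* The bracket in the statement is convertible to [odd_bracket]; once it is folded, [field] has
     only the prefactors to compare. *)
  change (2 ^ (2 * m + 1) / (2 * INR (2 * m + 1) * binom (2 * m) m)
      * odd_bracket m x (sqrt (1 - x ^ 2)) (asin x) / x ^ (2 * m + 1)
    = 2 ^ (2 * m + 1) / x ^ (2 * m + 1) / (2 * INR (2 * m + 1) * binom (2 * m) m)
      * odd_bracket m x (sqrt (1 - x ^ 2)) (asin x)).
  field. repeat split; lra.
Qed.
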